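(* Let $\alpha$ be an infinite cardinal, let $I=\{X: X\subseteq\alpha,\ X\text{ finite}\}$, and let $\mathcal K$ be a class of algebras of a fixed type. Then there exists an $\alpha$-regular ultrafilter $U$ on $I$ (not depending on the algebra below) such that for every algebra $\mathbf A=(A,\mathrm F)$ of that type with $|A|\leq\alpha$ and every injective map $i_A:A\to\alpha$ for which $\mathbf A$ satisfies the general finite $\alpha$-embedding property for $\mathcal K$ (with respect to $i_A$), there exist algebras $\mathbf A_X\in\mathcal K$, $X\in I$, such that $\mathbf A$ can be embedded into the ultraproduct $(\prod_{X\in I}\mathbf A_X)/U$.
   Context: For an algebra $\mathbf A$ and $Y\subseteq A$, the partial algebra $\mathbf A|_Y$ has universe $Y$, and for an $n$-ary operation $f$ and $x_1,\dots,x_n\in Y$, $f^{\mathbf A|_Y}(x_1,\dots,x_n)$ is defined iff $f^{\mathbf A}(x_1,\dots,x_n)\in Y$, and then equals it. An embedding of $\mathbf A|_Y$ into an algebra $\mathbf B$ is an injective map $\rho:Y\to B$ with $\rho(f^{\mathbf A|_Y}(x_1,\dots,x_n))=f^{\mathbf B}(\rho(x_1),\dots,\rho(x_n))$ whenever the left side is defined. Given $|A|\leq\alpha$ and an injective $i_A:A\to\alpha$, $\mathbf A$ satisfies the general finite $\alpha$-embedding property for $\mathcal K$ if for every finite $X\subseteq\alpha$ there exist $\mathbf B\in\mathcal K$ and an embedding $\mathbf A|_{i_A^{-1}(X)}\hookrightarrow\mathbf B$. A proper filter $D$ on a set $I$ is $\alpha$-regular if there is $E\subseteq D$ with $|E|=\alpha$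 such that each $i\in I$ belongs to only finitely many members of $E$. For algebras $\mathbf A_X$ and an ultrafilter $U$ on $I$, $(\prod_{X\in I}\mathbf A_X)/U$ is the quotient of the product by the congruence identifying $x,y$ iff $\{X: x(X)=y(X)\}\in U$. *)

(* Defs.v *)
From HB Require Import structures.
From mathcomp Require Export all_boot finmap.
From mathcomp Require Export boolp classical_sets functions cardinality filter.

Set Implicit Arguments.
Unset Strict Implicit.
Unset Printing Implicit Defensive.

Local Open Scope quotient_scope.
Local Open Scope classical_set_scope.
Local Open Scope card_scope.

Record algebra_type := AlgebraType {
  symbol : Type;
  arity : symbol -> nat }.

Record algebra (S : algebra_type) := Algebra {
  carrier :> Type;
  op : forall f : symbol S, ('I_(arity f) -> carrier) -> carrier }.

(* [pop f x = None] encodes that [f] is undefined at [x]. *)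
Record partial_algebra (S : algebra_type) := PartialAlgebra {
  pcarrier :> Type;
  pop : forall f : symbol S, ('I_(arity f) -> pcarrier) -> option pcarrier }.

Section Embeddings.
Variable S : algebra_type.

(* The universe is the subtype of elements of [Y]; [insub z] is [Some] of the
   element of [Y] with value [z] when [z] is in [Y], and [None] otherwise. *)
Definition restrict_algebra (A : algebra S) (Y : set A) : partial_algebra S :=
  @PartialAlgebra S (set_type Y)
    (fun f x => insub (op (fun j => val (x j)))).

Definition partial_embedding (P : partial_algebra S) (B : algebra S)
    (rho : P -> B) : Prop :=
  injective rho /\
  forall (f : symbol S) (x : 'I_(arity f) -> P) (y : P),
    pop x = Some y -> rho y = op (fun j => rho (x j)).

Definition embedding (A B : algebra S) (h : A -> B) : Prop :=
  injective h /\
  forall (f : symbol S) (x : 'I_(arity f) -> A),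
    h (op x) = op (fun j => h (x j)).

Definition embeddable (A B : algebra S) : Prop :=
  exists h : A -> B, embedding h.

(* [K] is a bare predicate because [set (algebra S)] would force the universe of
   carriers strictly below that of [eqType], hence below that of [{eq_quot _}].
*)
Definition general_finite_embedding_property (alpha : choiceType)
    (K : algebra S -> Prop) (A : algebra S) (iA : A -> alpha) : Prop :=
  forall X : {fset alpha}, exists B : algebra S, K B /\
    exists rho : restrict_algebra (iA @^-1` [set` X]) -> B,
      partial_embedding rho.

End Embeddings.

(* The cardinal is given by a type [alpha] of that cardinality. *)
Definition regular_filter (alpha I : Type) (D : set_system I) : Prop :=
  ProperFilter D /\
  exists E : set (set I),
    [/\ E `<=` D, E #= [set: alpha] &
        forall i : I, finite_set [set e | E e /\ e i]].

Section Ultraproduct.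
Variables (S : algebra_type) (I : Type) (A : I -> algebra S).
Variables (U : set_system I) (UU : UltraFilter U).

Definition product : Type := forall i, A i.

HB.instance Definition _ := gen_eqMixin product.
HB.instance Definition _ := gen_choiceMixin product.

Definition agree (x y : product) : bool := `[< U [set i | x i = y i] >].

Lemma agree_equiv : equiv_class_of agree.
Proof.
have FU : Filter U by exact: filter_filter.
split=> [x|x y|y x z].
- by apply/asboolP; apply: filterS filterT.
- by apply/asboolP/asboolP; apply: filterS => i.
- move=> /asboolP xy /asboolP yz; apply/asboolP.
  by apply: filterS2 xy yz => i /= ->.
Qed.

Canonical agree_equiv_rel := EquivRelPack agree_equiv.

Definition ultraproduct_carrier : Type := {eq_quot agree_equiv_rel}.

Definition ultraproduct_class (x : product) : ultraproduct_carrier :=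
  \pi_({eq_quot agree_equiv_rel}) x.

Definition ultraproduct : algebra S :=
  @Algebra S ultraproduct_carrier (fun f c =>
    ultraproduct_class (fun i => op (fun j => repr (c j) i))).

Lemma ultraproduct_classP (x y : product) :
  ultraproduct_class x = ultraproduct_class y <-> U [set i | x i = y i].
Proof. by split=> [/eqmodP /asboolP|H] //; apply/eqmodP/asboolP. Qed.

(* The operations do not depend on the representatives chosen by [repr]. *)
Lemma ultraproduct_opE (f : symbol S) (x : 'I_(arity f) -> product) :
  @op S ultraproduct f (fun j => ultraproduct_class (x j)) =
  ultraproduct_class (fun i => op (fun j => x j i)).
Proof.
have FU : Filter U by exact: filter_filter.
apply/ultraproduct_classP.
have H (j : 'I_(arity f)) :
    U [set i | repr (ultraproduct_class (x j)) i = x j i].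
  by apply/ultraproduct_classP; rewrite /ultraproduct_class reprK.
apply: filterS (filter_forall FU H) => i /= Hi.
by congr op; apply: functional_extensionality_dep => j; exact: Hi.
Qed.

End Ultraproduct.

(* Main.v *)
Require Import Defs.
Local Open Scope classical_set_scope.
Local Open Scope card_scope.

(** The cones [{X | a \in X}], [a : alpha], have the finite intersection
    property, and any ultrafilter [U] containing them is regular, because [X]
    lies in the cone of [a] only for the finitely many [a \in X].  Embeddings
    [rho X] of the finite partial subalgebras [A|_(iA^-1 X)] glue to
    [a |-> [X |-> rho X a]]: a single instance of injectivity or of compatibility
    with an operation involves finitely many elements of [A], so it holds for
    every [X] in a finite intersection of cones. *)

Definition fset_cone (alpha : choiceType) (a : alpha) : set {fset alpha} :=
  [set X | a \in X].

(** The filter generated by the cones: [Y] encodes the intersection of the cones of its elements. *)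
Definition fset_above (alpha : choiceType) : set_system {fset alpha} :=
  [set P | exists Y : {fset alpha}, forall X, (Y `<=` X)%fset -> P X].

Lemma fset_above_proper (alpha : choiceType) : ProperFilter (@fset_above alpha).
Proof.
split; first by case=> Y /(_ Y (fsubset_refl Y)).
split=> [|P Q [Y YP] [Z ZQ]|P Q PQ [Y YP]]; first by exists fset0.
- exists (Y `|` Z)%fset => X YZX; split.
  + exact/YP/(fsubset_trans (fsubsetUl Y Z)).
  + exact/ZQ/(fsubset_trans (fsubsetUr Y Z)).
- by exists Y => X /YP /PQ.
Qed.

Lemma fset_above_cone (alpha : choiceType) (a : alpha) :
  fset_above alpha (fset_cone alpha a).
Proof. by exists [fset a]%fset => X; rewrite fsub1set. Qed.

(** Gives the family of cones cardinality exactly that of [alpha], as regularity requires. *)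
Lemma fset_cone_inj (alpha : choiceType) : injective (fset_cone alpha).
Proof.
move=> a b ab; have : fset_cone alpha a [fset a]%fset by exact: fset11.
by rewrite ab /fset_cone /= inE => /eqP.
Qed.

Lemma cone_filter_regular (alpha : choiceType) (D : set_system {fset alpha}) :
  ProperFilter D -> (forall a, D (fset_cone alpha a)) -> regular_filter alpha D.
Proof.
move=> PD Dcone; split=> //; exists (range (fset_cone alpha)); split.
- by move=> _ [a _ <-].
- by apply: inj_card_eq => a b _ _; exact: fset_cone_inj.
- move=> X; apply: (@sub_finite_set _ _ (fset_cone alpha @` [set` X])).
    by move=> _ [[a _ <-] aX]; exists a.
  exact/finite_image/finite_fset.
Qed.

Section LocalEmbeddings.
Variables (S : algebra_type) (alpha : choiceType) (A : algebra S).
Variables (iA : A -> alpha) (K : algebra S -> Prop).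

(* Members of [K] may be empty; enlarging [X] by [iA a0] forces [B] to have the
   element [r a0], which serves as the junk value outside [iA^-1 X]. *)
Lemma total_local_embedding (a0 : A) (X : {fset alpha}) :
  general_finite_embedding_property K iA ->
  exists B : algebra S, K B /\ exists r : A -> B,
    (forall a b, iA a \in X -> iA b \in X -> r a = r b -> a = b) /\
    (forall (f : symbol S) (x : 'I_(arity f) -> A),
      (forall j, iA (x j) \in X) -> iA (op x) \in X ->
      r (op x) = op (fun j => r (x j))).
Proof.
move=> /(_ (iA a0 |` X)%fset) [B [KB [rho [rho_inj rho_op]]]].
exists B; split=> //.
set Y := (iA @^-1` _) in rho rho_inj rho_op.
have Y0 : a0 \in Y by rewrite inE /Y /= fset1U1.
have YX a : iA a \in X -> a \in Y by move=> aX; rewrite inE /Y /= fset1Ur.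
exists (fun a => rho (insubd (exist _ a0 Y0 : set_type Y) a)); split.
- move=> a b /YX aY /YX bY /rho_inj /(congr1 val).
  by rewrite !insubdK.
- move=> f x xX /YX opY; apply: rho_op => /=.
  have -> : (fun j => val (insubd (exist _ a0 Y0 : set_type Y) (x j))) = x.
    by apply: funext => j; rewrite insubdK //; exact: YX.
  (* Since [op x] lies in [Y], the partial operation is defined here. *)
  by rewrite /insubd; case: insubP => [u _ uE|]; rewrite ?opY // -uE valK.
Qed.

Lemma embeddable_ultraproduct_of_cones (U : set_system {fset alpha})
    (UU : UltraFilter U) :
  (forall a, U (fset_cone alpha a)) ->
  general_finite_embedding_property K iA ->
  exists AX : {fset alpha} -> algebra S,
    (forall X, K (AX X)) /\ embeddable A (ultraproduct AX UU).
Proof.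
move=> Ucone gfep; have FU : Filter U by exact: filter_filter.
(* If [A] is empty there is no [a0], but then the empty map is an embedding into any
   ultraproduct. *)
have [[a0]|A0] := pselect (inhabited A); last first.
  have [AX AXP] := choice gfep.
  exists AX; split=> [X|]; first by case: (AXP X).
  have noA (a : A) : False by exact: A0.
  exists (fun a => False_rect _ (noA a)).
  by split=> [a|f x]; [case: (noA a) | case: (noA (op x))].
have [AX AXP] := choice (fun X => total_local_embedding a0 X gfep).
exists AX; split=> [X|]; first by case: (AXP X).
pose r X := projT1 (cid (AXP X).2).
have r_inj X := (projT2 (cid (AXP X).2)).1.
have r_op X := (projT2 (cid (AXP X).2)).2.
exists (fun a => ultraproduct_class UU (fun X => r X a)); split.
- move=> a b /ultraproduct_classP ab.
  have PU : ProperFilter U by exact: ultra_proper.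
  (* Members of a proper filter are nonempty, so a single [X] contains both indices and identifies
     the images. *)
  have [X [[aX bX] abX]] :=
    filter_ex (filterI (filterI (Ucone (iA a)) (Ucone (iA b))) ab).
  exact: r_inj abX.
- move=> f x; rewrite ultraproduct_opE; apply/ultraproduct_classP.
  (* Arities are finite, so the cones of all arguments meet in a member of [U]. *)
  have Ux := filter_forall FU (fun j => Ucone (iA (x j))).
  by apply: filterS2 Ux (Ucone (iA (op x))) => X xX opX; exact: r_op.
Qed.

End LocalEmbeddings.

Theorem theorem9 (S : algebra_type) (alpha : choiceType)
    (alpha_infinite : infinite_set [set: alpha]) (K : algebra S -> Prop) :
  exists (U : set_system {fset alpha}) (UU : UltraFilter U),
    regular_filter alpha U /\
    forall (A : algebra S) (iA : A -> alpha),
      [set: A] #<= [set: alpha] ->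
      injective iA ->
      general_finite_embedding_property K iA ->
      exists AX : {fset alpha} -> algebra S,
        (forall X, K (AX X)) /\ embeddable A (ultraproduct AX UU).
Proof.
(* The extended filter depends on [alpha] alone, so one [U] serves every [A]. *)
have [U [UU subU]] := ultraFilterLemma (fset_above_proper alpha).
have Ucone a : U (fset_cone alpha a) by exact/subU/fset_above_cone.
exists U, UU; split; first exact: cone_filter_regular.
by move=> A iA _ _; exact: embeddable_ultraproduct_of_cones.
Qed.
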